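(* For every semiconvergent $\{x,y\}$-decorated rooted forest $F$, the arborified polylogarithm $Li^T_F$ enjoys the following properties: (1) it is a $\mathbb{Q}$-linear (finite) combination of multiple polylogarithms $Li_w$, $w$ semiconvergent words in the alphabet $\{x,y\}$; (2) it is a smooth map on $[0,1[$. Moreover, (3) the arborified polylogarithm map $Li^T: F\mapsto Li^T_F$, extended linearly to the linear span of semiconvergent forests, is an algebra morphism for the concatenation of forests and the pointwise product of functions.
   Context: A rooted forest is a finite (possibly empty) disjoint union of finite (non-planar) rooted trees; an $\Omega$-decorated forest carries a map from its vertex set to $\Omega$; forests are taken up to isomorphism. $\mathcal{F}_\Omega$ is the commutative unital $\mathbb{R}$-algebra freely generated by nonempty $\Omega$-decorated rooted trees: product is concatenation (disjoint union), unit is the empty forest $\emptyset$, forests form a basis. $B_+^\omega(F)$ is the tree obtained from $F$ by adding a new root decorated by $\omega$ joined to every root of $F$. A leaf is a vertex with no successor (children side); a branching vertex is a vertex with strictly more than one direct successor (child). A forest in $\mathcal{F}_{\{x,y\}}$ is semiconvergent if all its leaves and all its branching vertices are decorated by $y$ (the empty forest is semiconvergent). The linear span of semiconvergent forests is a subalgebra of $\mathcal{F}_{\{x,y\}}$. A word in the alphabet $\{x,y\}$ is semiconvergent if it is empty or ends with $y$. Let $\sigma_x(t)=1/t$, $\sigma_y(t)=1/(1-t)$. For $0<\epsilon<1$ define functions $A_\epsilon(F)$ on $[\epsilon,1[$ by $A_\epsilon(\emptyset)=1$, $A_\epsilon(F_1F_2)=A_\epsilon(F_1)A_\epsilon(F_2)$,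 $A_\epsilon(B_+^{\omega}(F))(z)=\int_\epsilon^z\sigma_\omega(t)A_\epsilon(F)(t)\,dt$ for $\omega\in\{x,y\}$. For semiconvergent $F$ and $z\in]0,1[$, $Li^T_F(z)=\lim_{\epsilon\to0^+}A_\epsilon(F)(z)$ (the limit exists), and $Li^T_F(0)=0$ for $F\neq\emptyset$, $Li^T_\emptyset=1$ identically. For a semiconvergent word $w=(\omega_1\cdots\omega_k)$, the (single variable) multiple polylogarithm is $Li_w=Li^T_{\ell}$ with $\ell=B_+^{\omega_1}\circ\cdots\circ B_+^{\omega_k}(\emptyset)$ the associated ladder tree; explicitly $Li_w(z)=\lim_{\epsilon\to 0^+}\int_{z\ge t_1\ge\cdots\ge t_k\ge\epsilon}\prod_i\sigma_{\omega_i}(t_i)dt_i$. *)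

(* Defs.v *)
From HB Require Import structures.
From Stdlib Require List.
From mathcomp Require Import all_boot all_order all_algebra generic_quotient.
From mathcomp Require Import finmap.
From mathcomp Require Import all_classical all_reals all_analysis.
(* The notations of monalg clash with those of mathcomp-analysis. *)
From mathcomp Require Import -(notations) monalg.
Import Order.TTheory GRing.Theory Num.Theory numFieldNormedType.Exports.

Set Implicit Arguments.
Unset Strict Implicit.
Unset Printing Implicit Defensive.

Local Open Scope quotient_scope.
Local Open Scope classical_set_scope.
Local Open Scope ring_scope.

(* Planar rooted trees with vertices decorated by Omega: [PNode w s] has a root
   decorated by w, and s is the list of the subtrees hanging from that root.
   These are only representatives for the non-planar trees defined below. *)
Inductive ptree (Omega : Type) : Type :=
  PNode of Omega & seq (ptree Omega).

Section PlanarTrees.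
Variable Omega : Type.

Fixpoint ptree_nested_ind (P : ptree Omega -> Prop)
    (IH : forall w s, List.Forall P s -> P (PNode w s)) (t : ptree Omega) : P t :=
  let: PNode w s := t in
  IH w s ((fix f s : List.Forall P s :=
    if s is u :: s' then
      @List.Forall_cons _ P u s' (ptree_nested_ind IH u) (f s')
    else @List.Forall_nil _ P) s).

Fixpoint ptree_encode (t : ptree Omega) : GenTree.tree Omega :=
  let: PNode w s := t in GenTree.Node 0 (GenTree.Leaf w :: map ptree_encode s).

Fixpoint ptree_decode (t : GenTree.tree Omega) : option (ptree Omega) :=
  if t is GenTree.Node _ (GenTree.Leaf w :: s)
  then Some (PNode w (pmap ptree_decode s)) else None.

Lemma ptree_encodeK : pcancel ptree_encode ptree_decode.
Proof.
elim/ptree_nested_ind => w s IH /=; congr (Some (PNode w _)).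
by elim: IH => //= u r -> _ ->.
Qed.

End PlanarTrees.

HB.instance Definition _ (Omega : choiceType) :=
  Choice.copy (ptree Omega) (pcan_type (@ptree_encodeK Omega)).

(* Isomorphism of the underlying non-planar decorated rooted trees. *)
Inductive piso (Omega : choiceType) : ptree Omega -> ptree Omega -> Prop :=
  PIso w s s' r : perm_eq s s' -> List.Forall2 (@piso Omega) s' r ->
    piso (PNode w s) (PNode w r).

Section Isomorphism.
Variable Omega : choiceType.
Implicit Types t u v : ptree Omega.

Lemma pisoE w s t : piso (PNode w s) t ->
  exists s' r, [/\ t = PNode w r, perm_eq s s' & List.Forall2 (@piso Omega) s' r].
Proof.
move=> h; inversion h as [w' s1 s' r p f e1 e2]; subst.
by exists s', r.
Qed.

Lemma Forall2_perm (T T' : eqType) (P : T -> T' -> Prop) a b b' :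
  List.Forall2 P a b -> perm_eq b b' ->
  exists2 a', perm_eq a a' & List.Forall2 P a' b'.
Proof.
move=> h; elim: h b' => {a b} [|x y a b Pxy _ IH] b'.
  by rewrite perm_sym => /perm_nilP ->; exists [::].
move=> pb; have yb' : y \in b' by rewrite -(perm_mem pb) mem_head.
case/splitPr: yb' pb => b1 b2.
rewrite -(cat1s y b2) perm_sym perm_catCA /= perm_cons perm_sym => /IH [a' pa fa].
have [a1 [a2 [f1 [f2 ea]]]] := List.Forall2_app_inv_r _ _ fa.
exists (a1 ++ x :: a2).
  by rewrite -(cat1s x a2) perm_sym perm_catCA /= perm_cons perm_sym; rewrite ea in pa.
by apply: List.Forall2_app => //; constructor.
Qed.

Lemma piso_refl t : piso t t.
Proof.
elim/ptree_nested_ind: t => w s IH; apply: (PIso w (perm_refl s)).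
by elim: IH => [|u r ? _ ?]; constructor.
Qed.

Lemma Forall_perm (T : eqType) (P : T -> Prop) s s' :
  List.Forall P s -> perm_eq s s' -> List.Forall P s'.
Proof.
move=> h p; have {h} : forall x, x \in s -> P x.
  elim: h {p} => // x r Px _ IH y; rewrite in_cons => /orP[/eqP -> //|]; exact: IH.
move=> h; have {h} : forall x, x \in s' -> P x.
  by move=> x; rewrite -(perm_mem p); exact: h.
elim: s' {p} => [|x r IH] h; constructor; first by apply: h; rewrite mem_head.
by apply: IH => y yr; apply: h; rewrite in_cons yr orbT.
Qed.

Lemma piso_sym t u : piso t u -> piso u t.
Proof.
elim/ptree_nested_ind: t u => w s IH u /pisoE [s' [r [-> p f]]].
have f' : List.Forall2 (@piso Omega) r s'.
  move: (Forall_perm IH p); elim: f => [|x y a b Pxy _ IHf] IHs; constructor.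
    by inversion IHs; auto.
  by inversion IHs; auto.
rewrite perm_sym in p.
have [r' pr fr] := Forall2_perm f' p.
exact: PIso pr fr.
Qed.

Lemma piso_trans t u v : piso t u -> piso u v -> piso t v.
Proof.
elim/ptree_nested_ind: t u v => w s IH u v /pisoE [s' [r [-> p f]]].
move=> /pisoE [r' [q [-> p' f']]].
have [s'' ps fs] := Forall2_perm f p'.
have {}p := perm_trans p ps.
apply: (PIso w p) => {u v f ps p'}.
move: (Forall_perm IH p) => {p IH}.
elim: f' s'' fs => [|x y a b Pxy _ IHf] s'' fs IHs; inversion fs; subst.
  by constructor.
by inversion IHs; subst; constructor; [eauto | exact: IHf].
Qed.

End Isomorphism.

Section Forests.
Variable Omega : choiceType.

Definition pisob (t u : ptree Omega) : bool := `[< piso t u >].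

Lemma pisob_refl : reflexive pisob.
Proof. by move=> t; apply/asboolP; exact: piso_refl. Qed.

Lemma pisob_sym : symmetric pisob.
Proof. by move=> t u; apply/asboolP/asboolP; exact: piso_sym. Qed.

Lemma pisob_trans : transitive pisob.
Proof.
by move=> t u v /asboolP h /asboolP h'; apply/asboolP; exact: piso_trans h h'.
Qed.

Canonical pisob_equiv := EquivRel pisob pisob_refl pisob_sym pisob_trans.

(* Nonempty Omega-decorated (non-planar) rooted trees up to isomorphism. *)
Definition tree := {eq_quot pisob}.
HB.instance Definition _ := Choice.on tree.
HB.instance Definition _ := EqQuotient.on tree.

(* A forest is a finite multiset of trees: F t is the number of components of F
   isomorphic to t; concatenation is mulcm and the empty forest is onecm. *)
Definition forest := cmonom tree.
HB.instance Definition _ := Choice.on forest.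
HB.instance Definition _ := ConomialDef.on forest.

Definition components (F : forest) : seq tree :=
  flatten [seq nseq (F t) t | t <- finsupp F].

Definition bplus (w : Omega) (F : forest) : tree :=
  \pi_tree (PNode w [seq repr t | t <- components F]).

Fixpoint ladder (w : seq Omega) : forest :=
  if w is a :: w' then ucm (bplus a (ladder w')) else onecm tree.

Lemma piso_bplus w F :
  piso (repr (bplus w F)) (PNode w [seq repr t | t <- components F]).
Proof. by apply/asboolP/(@eqquotP _ _ tree); exact: reprK. Qed.

End Forests.

(* The algebra F_Omega: forests form a basis, the product extends concatenation. *)
Notation forest_alg R Omega := (malg (forest Omega) R).

Definition forest_vec (R : nzRingType) (Omega : choiceType) (F : forest Omega)
  : forest_alg R Omega := mkmalgU F 1.

Inductive letter := x_ | y_.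

Definition letter_is_y (a : letter) := if a is y_ then true else false.
Definition letter_of_bool (b : bool) := if b then y_ else x_.
Lemma letter_is_yK : cancel letter_is_y letter_of_bool. Proof. by case. Qed.
HB.instance Definition _ := Choice.copy letter (can_type letter_is_yK).

(* Leaves are the vertices with 0 children, branching vertices those with at
   least 2 children. *)
Fixpoint psemiconv (t : ptree letter) : bool :=
  let: PNode w s := t in
  ((size s == 0%N) || (1 < size s)%N ==> (w == y_)) && all psemiconv s.

Definition semiconv (F : forest letter) : bool :=
  all (fun t => psemiconv (repr t)) (finsupp F).

Definition word_semiconv (w : seq letter) : bool :=
  if w is a :: w' then last a w' == y_ else true.

Lemma psemiconv_iso (t u : ptree letter) : piso t u -> psemiconv t = psemiconv u.
Proof.
elim/ptree_nested_ind: t u => w s IH u /pisoE [s' [r [-> p f]]] /=.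
rewrite (perm_size p) (perm_all _ p).
have -> : size s' = size r by elim: f => //= ? ? ? ? _ _ ->.
congr andb; move: (Forall_perm IH p).
elim: f => //= a b s1 s2 ab _ IHf IHs.
by inversion IHs; subst; congr andb; auto.
Qed.

Lemma size_components (F : forest letter) : size (components F) = mdeg F.
Proof.
rewrite /components size_flatten /shape -map_comp sumnE big_map.
by apply: eq_bigr => t _ /=; rewrite size_nseq.
Qed.

Lemma mem_components (F : forest letter) : components F =i finsupp F.
Proof.
move=> t; apply/flatten_mapP/idP => [[u uF]|tF].
  by rewrite mem_nseq => /andP[_ /eqP ->].
by exists t; rewrite // mem_nseq eqxx andbT lt0n cmE_neq0.
Qed.

Lemma semiconv_bplus w F :
  psemiconv (repr (bplus w F)) = ((mdeg F != 1%N) ==> (w == y_)) && semiconv F.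
Proof.
rewrite (psemiconv_iso (piso_bplus w F)) /= size_map size_components.
rewrite all_map (eq_all_r (mem_components F)); congr ((_ ==> _) && _).
by case: (mdeg F) => [|[]].
Qed.

Lemma semiconv1 : semiconv (onecm _).
Proof. by apply/allP => t; rewrite -cmE_neq0 onecmE. Qed.

Lemma semiconvM F G : semiconv (mulcm F G) = semiconv F && semiconv G.
Proof.
apply/allP/andP => [h|[/allP hF /allP hG] t].
  by split; apply/allP => t tF; apply: h; rewrite mdomD in_fsetU tF ?orbT.
by rewrite mdomD in_fsetU => /orP[/hF|/hG].
Qed.

Section SemiconvAlg.
Variable R : realType.

Definition semiconv_span : {pred forest_alg R letter} :=
  [pred P | `[< exists2 s : seq (R * forest letter),
                  all (fun p => semiconv p.2) s &
                  P = \sum_(p <- s) p.1 *: forest_vec R p.2 >]].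

Lemma forest_vec1 : forest_vec R (onecm _) = 1 :> forest_alg R letter.
Proof. by []. Qed.

Lemma forest_vecM (F G : forest letter) :
  forest_vec R (mulcm F G) = forest_vec R F * forest_vec R G.
Proof. by rewrite malgM_def fgmulUU mulr1. Qed.

Lemma semiconv_span_closed : subalg_closed semiconv_span.
Proof.
split.
- apply/asboolP; exists [:: (1, onecm _)]; first by rewrite /= semiconv1.
  by rewrite big_seq1 scale1r forest_vec1.
- move=> c P Q /asboolP[s hs ->] /asboolP[r hr ->]; apply/asboolP.
  exists ([seq (c * p.1, p.2) | p <- s] ++ r); first by rewrite all_cat all_map hr andbT.
  rewrite big_cat /=; congr (_ + _); rewrite big_map /=.
  transitivity (\sum_(p <- s) c *: (p.1 *: forest_vec R p.2)).
    exact: scaler_sumr.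
  by apply: eq_bigr => p _; exact: scalerA.
- move=> P Q /asboolP[s hs ->] /asboolP[r hr ->]; apply/asboolP.
  exists [seq (p.1 * q.1, mulcm p.2 q.2) | p <- s, q <- r].
    apply/allP => _ /allpairsP[[p q] [/= ps qr ->]] /=.
    by rewrite semiconvM (allP hs _ ps) (allP hr _ qr).
  rewrite big_allpairs_dep mulr_suml; apply: eq_bigr => p _.
  rewrite mulr_sumr; apply: eq_bigr => q _ /=.
  by rewrite forest_vecM -scalerAl -scalerAr scalerA.
Qed.

HB.instance Definition _ := GRing.isSubalgClosed.Build R
  (forest_alg R letter) semiconv_span (GRing.subalg_closed_semi semiconv_span_closed).

Record semiconv_alg := SemiconvAlg {
  semiconv_val :> forest_alg R letter;
  _ : semiconv_val \in semiconv_span }.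

HB.instance Definition _ := [isSub for semiconv_val].
HB.instance Definition _ := [Choice of semiconv_alg by <:].
HB.instance Definition _ := [SubChoice_isSubAlgebra of semiconv_alg by <:].

End SemiconvAlg.

Section Polylogarithms.
Variable R : realType.
Implicit Types (F G : forest letter) (eps z : R).

Definition sigma (a : letter) (t : R) : R :=
  match a with x_ => t^-1 | y_ => (1 - t)^-1 end.

Local Notation mu := (@lebesgue_measure R).

Fixpoint pA (eps : R) (t : ptree letter) : R -> R :=
  let: PNode w s := t in fun z =>
    \int[mu]_(u in `[eps, z])
      (sigma w u * foldr (fun t' p => pA eps t' u * p) 1 s).

Definition A_ (eps : R) (F : forest letter) (z : R) : R :=
  \prod_(t <- components F) pA eps (repr t) z.

Lemma pA_node eps w s z : pA eps (PNode w s) z =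
  \int[mu]_(u in `[eps, z]) (sigma w u * \prod_(t <- s) pA eps t u).
Proof.
rewrite /=; congr (Rintegral _ _ _); apply/funext => u; congr (_ * _).
by elim: s => [|t s IH] /=; rewrite ?big_nil // big_cons IH.
Qed.

Lemma pA_iso eps (t u : ptree letter) : piso t u -> pA eps t = pA eps u.
Proof.
elim/ptree_nested_ind: t u => w s IH u /pisoE [s' [r [-> p f]]].
apply/funext => z; rewrite !pA_node.
congr (Rintegral _ _ _); apply/funext => v; congr (_ * _).
rewrite (perm_big _ p) /=; move: (Forall_perm IH p).
elim: f => [|a b s1 s2 ab _ IHf] IHs; first by rewrite !big_nil.
by rewrite !big_cons; inversion IHs; subst; rewrite IHf //; congr (_ * _); rewrite (H1 b).
Qed.

(* A_ satisfies the defining recursion of the iterated integrals. *)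
Lemma A_empty eps z : A_ eps (onecm _) z = 1.
Proof. by rewrite /A_ /components mdom1 big_nil. Qed.

Lemma A_expE eps F (d : {fset tree letter}) z : (finsupp F `<=` d)%fset ->
  A_ eps F z = \prod_(t <- d) pA eps (repr t) z ^+ F t.
Proof.
move=> sub; rewrite /A_ /components big_flatten big_map /=.
rewrite -(big_fset_incl _ sub) => [|t _]; last first.
  by rewrite -cmE_eq0 => /eqP ->; rewrite expr0.
by apply: eq_bigr => t _; rewrite big_nseq -Monoid.iteropE.
Qed.

Lemma A_concat eps F G z : A_ eps (mulcm F G) z = A_ eps F z * A_ eps G z.
Proof.
rewrite !(@A_expE _ _ (finsupp F `|` finsupp G)%fset) ?fsubsetUl ?fsubsetUr //.
  by rewrite -big_split /=; apply: eq_bigr => t _; rewrite mulcmE exprD.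
by rewrite mdomD.
Qed.

Lemma A_bplus eps w F z : A_ eps (ucm (bplus w F)) z =
  \int[mu]_(u in `[eps, z]) (sigma w u * A_ eps F u).
Proof.
rewrite (@A_expE _ _ [fset bplus w F]%fset) ?mdomU // big_seq_fset1 ucmE eqxx expr1.
rewrite (pA_iso eps (piso_bplus w F)) pA_node.
by congr (Rintegral _ _ _); apply/funext => u; rewrite big_map.
Qed.

(* Only the values for semiconvergent F and z in [0, 1[ are meaningful. *)
Definition LiT (F : forest letter) (z : R) : R :=
  if z == 0 then (F == onecm _)%:R
  else lim (A_ eps F z @[eps --> 0^'+]).

Definition Li (w : seq letter) : R -> R := LiT (ladder w).

Definition Ico01 := {z : R | z \in `[0, 1[%R}.

(* The linear extension of F |-> LiT F to the span of semiconvergent forests,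
   with values in the algebra of real functions on [0, 1[. *)
Definition LiT_lin (P : semiconv_alg R) : Ico01 -> R :=
  \sum_(F <- msupp (P : forest_alg R letter))
    mcoeff F (P : forest_alg R letter) *: (fun z : Ico01 => LiT F (val z)).

(* g is the derivative of f on A, where the difference quotients only involve
   points of A (hence a one-sided derivative at an endpoint of an interval). *)
Definition derivative_on (A : set R) (f g : R -> R) : Prop :=
  forall z, A z ->
    (f w - f z) / (w - z) @[w --> within (A `\ z) (nbhs z)] --> g z.

Definition smooth_on (A : set R) (f : R -> R) : Prop :=
  exists D : nat -> R -> R,
    D 0%N = f /\ forall n, derivative_on A (D n) (D n.+1).

End Polylogarithms.

(* Main.v *)
Require Import Defs.
From mathcomp Require Import all_boot all_order all_algebra.
From mathcomp Require Import finmap.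
From mathcomp Require Import all_classical all_reals all_analysis.
From mathcomp Require Import -(notations) monalg.
From mathcomp Require Import ring lra.
Import Order.TTheory GRing.Theory Num.Theory numFieldNormedType.Exports.

(** Why the theorem holds.  For a fixed [eps > 0] everything is an iterated
integral of continuous functions.  By the Leibniz rule the product of two
iterated integrals along nonempty words [u] and [v] has the same derivative as the sum of
the iterated integrals along the shuffles of [u] and [v], and both vanish at
[eps]; hence they agree ([A_ladder_shuffle]).  By induction on trees, [A_ eps F]
is on [eps, 1[ the sum of the [A_ eps (ladder w)], for [w] running over the
linear extensions of [F] read from the roots to the leaves ([A_words]).  The last
letter of such a word decorates a leaf, so all these words are semiconvergent
when [F] is.

It remains to let [eps] tend to 0 for a single semiconvergent word.  The limit is
a power series with coefficients in [0, 1]: integrating against [dt / t]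
divides the [n]th coefficient by [n], integrating against [dt / (1 - t)] replaces
it by the mean of the preceding ones.  The word ends with [y], which
makes the constant term vanish whenever one integrates against [dt / t].  The gap
between this series and the truncated integral is nonnegative and at most
[K * sqrt eps * sqrt z] on [eps, b], by induction on the word
([word_fun_approx]): the geometric mean of [eps] and [z] is used because it
is at least [eps] for [z >= eps], tends to 0 with [eps], and is reproduced up to a constant
by integration against [dt / t], so that no logarithm ever appears.

Consequently [LiT F] is, on [0, 1[, both a sum of functions [Li w] and a power
series converging on the unit disc; the latter gives smoothness, including the
one-sided derivatives at 0.  Multiplicativity passes to the limit from
[A_concat].  The linear extension is evaluated on combinations of forests, for
which bilinearity reduces the product to that of two forests. *)

Set Implicit Arguments.
Unset Strict Implicit.
Unset Printing Implicit Defensive.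

Local Open Scope classical_set_scope.
Local Open Scope ring_scope.

(** * Shuffles and the words of a forest *)

Section Shuffle.
Variable T : eqType.
Implicit Types (u v w : seq T) (U V : seq (seq T)).

(** The inner recursion on [v] is a nested [fix], as neither argument decreases
in both recursive calls. *)
Fixpoint shuffle u : seq T -> seq (seq T) :=
  if u is a :: u' then
    fix shuffle_u v := if v is b :: v' then
        [seq a :: w | w <- shuffle u' v] ++ [seq b :: w | w <- shuffle_u v']
      else [:: u]
  else fun v => [:: v].

Lemma shuffle0r u : shuffle u [::] = [:: u].
Proof. by case: u. Qed.

Lemma shuffle_cons a u b v : shuffle (a :: u) (b :: v) =
  [seq a :: w | w <- shuffle u (b :: v)] ++ [seq b :: w | w <- shuffle (a :: u) v].
Proof. by []. Qed.

Lemma shuffle_ind (P : seq T -> seq T -> Prop) :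
  (forall v, P [::] v) -> (forall u, P u [::]) ->
  (forall a u b v, P u (b :: v) -> P (a :: u) v -> P (a :: u) (b :: v)) ->
  forall u v, P u v.
Proof.
move=> P0 Pr0 PS; elim=> // a u IHu; elim=> // b v IHv.
exact: PS.
Qed.

Lemma size_shuffle u v w : w \in shuffle u v -> size w = (size u + size v)%N.
Proof.
move: u v w; apply: shuffle_ind => [v|u|a u b v IHu IHv] w.
- by rewrite mem_seq1 => /eqP ->.
- by rewrite shuffle0r mem_seq1 => /eqP ->; rewrite addn0.
rewrite shuffle_cons mem_cat => /orP[] /mapP[w' w'in ->] /=.
  by rewrite (IHu _ w'in).
by rewrite (IHv _ w'in) addnS.
Qed.

Definition shuffles U V := flatten [seq shuffle u v | u <- U, v <- V].

Lemma shufflesP U V w :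
  reflect (exists u v, [/\ u \in U, v \in V & w \in shuffle u v]) (w \in shuffles U V).
Proof.
apply: (iffP flattenP) => [[s /allpairsP[[u v] /= [uU vV ->]] ws]|[u [v [uU vV ws]]]].
  by exists u, v.
by exists (shuffle u v) => //; apply/allpairsP; exists (u, v).
Qed.

End Shuffle.

(** The words read along the linear extensions of a tree.  The fold over the
subtrees is that of [trees_words], inlined for the sake of the guard condition. *)
Fixpoint tree_words (T : eqType) (t : ptree T) : seq (seq T) :=
  let: PNode a s := t in
  [seq a :: w | w <- foldr (fun u W => shuffles (tree_words u) W) [:: [::]] s].

Definition trees_words (T : eqType) (s : seq (ptree T)) : seq (seq T) :=
  foldr (fun u W => shuffles (tree_words u) W) [:: [::]] s.

Lemma tree_wordsE (T : eqType) a (s : seq (ptree T)) :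
  tree_words (PNode a s) = [seq a :: w | w <- trees_words s].
Proof. by []. Qed.

(** Words of a nonempty list of trees are nonempty because each contains the root
letters. *)
Lemma trees_words_nil (T : eqType) (s : seq (ptree T)) w :
  w \in trees_words s -> (w == [::]) = nilp s.
Proof.
case: s => [|[a s] r] /=; first by rewrite mem_seq1 => /eqP ->.
case/shufflesP => u [v [/mapP[u' _ ->] _ /size_shuffle]].
by case: w.
Qed.

Lemma word_semiconv_cons a w :
  word_semiconv (a :: w) = ((w == [::]) ==> (a == y_)) && word_semiconv w.
Proof. by case: w => //=; rewrite andbT. Qed.

(** The last letter of a shuffle is the last letter of one of its two factors. *)
Lemma shuffle_semiconv u v w : word_semiconv u -> word_semiconv v ->
  w \in shuffle u v -> word_semiconv w.
Proof.
move: u v w; apply: shuffle_ind => [v|u|a u b v IHu IHv] w.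
- by rewrite mem_seq1 => _ sv /eqP ->.
- by rewrite shuffle0r mem_seq1 => su _ /eqP ->.
move=> su sv; rewrite shuffle_cons mem_cat => /orP[] /mapP[w' w'in ->].
  rewrite word_semiconv_cons (IHu _ _ _ w'in) //; last first.
    by move: su; rewrite word_semiconv_cons => /andP[].
  by move: (size_shuffle w'in); case: (w') => //=; rewrite addnS.
rewrite word_semiconv_cons (IHv _ _ _ w'in) //; last first.
  by move: sv; rewrite word_semiconv_cons => /andP[].
by move: (size_shuffle w'in); case: (w').
Qed.

Lemma shuffles_semiconv U V : all word_semiconv U -> all word_semiconv V ->
  all word_semiconv (shuffles U V).
Proof.
move=> /allP sU /allP sV; apply/allP => w /shufflesP[u [v [/sU su /sV sv]]].
exact: shuffle_semiconv.
Qed.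

(** The root letter ends a word only when the root is a leaf, where it is [y_];
otherwise the word ends as a word of the subtrees does. *)
Lemma tree_words_semiconv t : psemiconv t -> all word_semiconv (tree_words t).
Proof.
elim/ptree_nested_ind: t => a s IH; rewrite tree_wordsE /= => /andP[ha hs].
have /allP sW : all word_semiconv (trees_words s).
  elim: IH hs {ha} => //= t r IHt _ IHr /andP[ht hr].
  by apply: shuffles_semiconv; [exact: IHt|exact: IHr].
apply/allP => _ /mapP[w ws ->]; rewrite word_semiconv_cons sW // andbT.
rewrite (trees_words_nil ws); apply/implyP => /nilP s0.
by move: ha; rewrite s0.
Qed.

Lemma trees_words_semiconv s : all psemiconv s -> all word_semiconv (trees_words s).
Proof.
elim: s => //= t s IH /andP[ht hs].
by apply: shuffles_semiconv; [exact: tree_words_semiconv|exact: IH].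
Qed.

Definition forest_words (F : forest letter) : seq (seq letter) :=
  trees_words [seq repr t | t <- components F].

Lemma forest_words_semiconv F : semiconv F -> all word_semiconv (forest_words F).
Proof.
move=> /allP sF; apply: trees_words_semiconv; rewrite all_map; apply/allP => t.
by rewrite mem_components => /sF.
Qed.

Lemma forest_words1 : forest_words (onecm _) = [:: [::]].
Proof. by rewrite /forest_words /components mdom1. Qed.

Lemma forest_words_nil F w : w \in forest_words F -> (w == [::]) = (F == onecm _).
Proof.
move/trees_words_nil ->; rewrite /nilp size_map size_components.
by rewrite mdeg_eq0.
Qed.

(** * Power series converging on the open unit disc *)

Section UnitSeries.
Variable R : realType.
Implicit Types (c d : R^nat) (x r : R).

(** Convergence on [0, 1[ alone already forces the radius of convergence to be at
least 1, by [unit_series_cvg]. *)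
Definition unit_series c := forall r, 0 <= r < 1 -> cvgn (pseries c r).

Definition psum c x : R := limn (pseries c x).

Lemma unit_series_cvg c x : unit_series c -> `|x| < 1 -> cvgn (pseries c x).
Proof.
move=> uc x1; apply: (@is_cvg_pseries_inside _ c ((1 + `|x|) / 2)).
  by apply: uc; have := normr_ge0 x; lra.
rewrite [ltRHS]ger0_norm; last by have := normr_ge0 x; lra.
lra.
Qed.

Lemma cvg_series_shift (u : R^nat) : cvgn (series u) ->
  series (fun n => u n.+1) @ \oo --> limn (series u) - u 0%N.
Proof.
move=> cu; have -> : series (fun n => u n.+1) = (fun n => series u n.+1 - u 0%N).
  apply/funext => n; rewrite /series /= [in RHS]big_nat_recl //=.
  by rewrite addrC addrA addNr add0r.
apply: cvgB; last exact: cvg_cst.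
rewrite (cvg_shiftS (series u)); exact: cu.
Qed.

Lemma unit_series_le c d : (forall n, `|d n| <= `|c n|) ->
  unit_series c -> unit_series d.
Proof.
move=> dc uc r /andP[r0 r1]; pose s := (1 + r) / 2.
have cr : cvgn (pseries (fun n => `|c n|) r).
  apply: (@is_cvg_pseries_inside_norm _ c s); first by apply: uc; rewrite /s; lra.
  by rewrite !ger0_norm /s; lra.
apply: normed_cvg; apply: series_le_cvg cr => n /=; first exact: normr_ge0.
  by rewrite mulr_ge0 // exprn_ge0.
by rewrite normrM normrX (ger0_norm r0) ler_wpM2r // exprn_ge0.
Qed.

Lemma unit_series_le1 c : (forall n, `|c n| <= 1) -> unit_series c.
Proof.
move=> c1; apply: (@unit_series_le (fun=> 1)) => [n|r /andP[r0 r1]].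
  by rewrite normr1.
have := @is_cvg_geometric_series R 1 r; rewrite ger0_norm // => /(_ r1).
exact.
Qed.

(** The left-hand side is at most the geometric sum [1 + p + ... + p ^+ n]. *)
Lemma natr_exp_le (p : R) n : 0 <= p < 1 -> n.+1%:R * p ^+ n <= (1 - p)^-1.
Proof.
move=> /andP[p0 p1]; rewrite -[leRHS]mul1r ler_pdivlMr ?subr_gt0 //.
apply: le_trans (_ : 1 - p ^+ n.+1 <= 1); last by rewrite gerBl exprn_ge0.
rewrite -[1 - p ^+ _](opprK) opprB subrX1 -mulNr opprB mulrC.
rewrite ler_wpM2l ?subr_ge0 ?(ltW p1) //.
rewrite mulr_natl -[n.+1 in leLHS]card_ord -sumr_const.
apply: ler_sum => i _; rewrite ler_wiXn2l // ?(ltW p1) //.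
by rewrite -ltnS ltn_ord.
Qed.

(** Between [r] and 1 there is room for [r < s < t < 1]: the factor [n.+1] is absorbed
by the ratio [(r / s) ^+ n] ([natr_exp_le]), and convergence at [t] gives absolute
convergence at [s]. *)
Lemma unit_series_diffs c : unit_series c -> unit_series (pseries_diffs c).
Proof.
move=> uc r /andP[r0 r1].
pose s := (1 + r) / 2; pose t := (1 + s) / 2.
have [s0 [rs [st t1]]] : 0 < s /\ r < s /\ s < t /\ t < 1.
  by rewrite /t /s; split; [|split; [|split]]; lra.
have cs : cvgn (pseries (fun n => `|c n|) s).
  apply: (@is_cvg_pseries_inside_norm _ c t); first by apply: uc; lra.
  by rewrite !ger0_norm //; lra.
have rs1 : 0 <= r / s < 1.
  by rewrite divr_ge0 ?(ltW s0) //= ltr_pdivrMr // mul1r.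
apply: normed_cvg.
apply: (@series_le_cvg _ _
    ((1 - r / s)^-1 / s *: (fun n => `|c n.+1| * s ^+ n.+1))).
- by move=> n /=; rewrite normr_ge0.
- move=> n; apply: mulr_ge0.
    by rewrite divr_ge0 ?(ltW s0) // invr_ge0 subr_ge0; case/andP: rs1 => _ /ltW.
  by rewrite mulr_ge0 // exprn_ge0 // ltW.
- move=> n; rewrite /pseries_diffs /= !normrM normrX (ger0_norm r0) normr_nat.
  have -> : n.+1%:R * `|c n.+1| * r ^+ n =
      (n.+1%:R * (r / s) ^+ n) * (s^-1 * (`|c n.+1| * s ^+ n.+1)).
    rewrite expr_div_n exprS; field.
    by rewrite (gt_eqF s0) expf_neq0 // gt_eqF.
  rewrite [leRHS](_ : _ =
      (1 - r / s)^-1 * (s^-1 * (`|c n.+1| * s ^+ n.+1))); last by rewrite mulrA.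
  rewrite ler_wpM2r ?natr_exp_le //.
  by rewrite !mulr_ge0 // ?invr_ge0 ?exprn_ge0 // ltW.
- apply: is_cvg_seriesZ; apply/cvg_ex; eexists.
  exact: (cvg_series_shift cs).
Qed.

Lemma psum_derive c x : unit_series c -> `|x| < 1 ->
  is_derive x 1 (psum c) (psum (pseries_diffs c) x).
Proof.
move=> uc x1; pose K := (1 + `|x|) / 2.
have K01 : 0 <= K < 1 by have := normr_ge0 x; rewrite /K; lra.
apply: (@pseries_snd_diffs _ c K); [exact: uc| | |].
- exact: (unit_series_diffs uc).
- exact: (unit_series_diffs (unit_series_diffs uc)).
- by rewrite (ger0_norm (proj1 (andP K01))) /K; lra.
Qed.

Lemma unit_series_shift c : unit_series c -> unit_series (fun n => c n.+1).
Proof.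
move=> uc; apply: unit_series_le (unit_series_diffs uc) => n.
by rewrite normrM normr_nat ler_peMl // ler1n.
Qed.

Lemma psum_shift c x : unit_series c -> `|x| < 1 ->
  psum c x = c 0%N + x * psum (fun n => c n.+1) x.
Proof.
move=> uc x1; have := cvg_series_shift (unit_series_cvg uc x1).
rewrite /= expr0 mulr1.
have -> : series (fun n => c n.+1 * x ^+ n.+1) = x *: pseries (fun n => c n.+1) x.
  apply/funext => n; rewrite /pseries /series /= [RHS]mulr_sumr.
  by apply: eq_bigr => i _; rewrite exprS mulrCA.
have : x *: pseries (fun n => c n.+1) x @ \oo --> x * psum (fun n => c n.+1) x.
  by apply: cvgZr; exact: unit_series_cvg (unit_series_shift uc) x1.
move=> /(cvg_unique (@Rhausdorff R)) /[apply] => ->.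
by rewrite addrC subrK.
Qed.

Lemma psum_at0 c : psum c 0 = c 0%N.
Proof.
apply: lim_near_cst => //; near=> n; rewrite /pseries /series /=.
have -> : n = n.-1.+1 by rewrite prednK //; near: n; exact: nbhs_infty_gt.
rewrite big_nat_recl //= expr0 mulr1 big1 ?addr0 // => i _.
by rewrite expr0n mulr0.
Unshelve. all: by end_near. Qed.

Lemma pseriesD c d x : pseries (c + d) x = pseries c x + pseries d x.
Proof.
apply/funext => n; rewrite /pseries /series /= [RHS]/GRing.add /= -big_split.
by apply: eq_bigr => i _; exact: mulrDl.
Qed.

Lemma unit_seriesD c d : unit_series c -> unit_series d -> unit_series (c + d).
Proof.
by move=> uc ud r r1; rewrite pseriesD; apply: is_cvgD; [exact: uc|exact: ud].
Qed.

Lemma psumD c d x : unit_series c -> unit_series d -> `|x| < 1 ->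
  psum (c + d) x = psum c x + psum d x.
Proof.
move=> uc ud x1; rewrite /psum -limD; [|exact: unit_series_cvg..].
by rewrite -pseriesD.
Qed.

Lemma unit_series0 : unit_series (0 : R^nat).
Proof. by apply: unit_series_le1 => n; rewrite normr0 ler01. Qed.

Lemma psum0 x : psum 0 x = 0.
Proof.
apply: cvg_lim => //; have -> : pseries 0 x = (fun=> 0).
  by apply/funext => n; rewrite /pseries /series /= big1 // => i _; rewrite mul0r.
exact: cvg_cst.
Qed.

Lemma unit_series_sum (I : Type) (s : seq I) (c : I -> R^nat) :
  (forall i, unit_series (c i)) -> unit_series (\sum_(i <- s) c i).
Proof.
by move=> uc; elim/big_ind: _ => //; [exact: unit_series0|exact: unit_seriesD].
Qed.

Lemma psum_sum (I : Type) (s : seq I) (c : I -> R^nat) x :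
  (forall i, unit_series (c i)) -> `|x| < 1 ->
  psum (\sum_(i <- s) c i) x = \sum_(i <- s) psum (c i) x.
Proof.
move=> uc x1; elim: s => [|i s IH]; first by rewrite !big_nil psum0.
by rewrite !big_cons psumD ?IH //; exact: unit_series_sum.
Qed.

(** Multiplication by [1 - x] takes the differences of consecutive coefficients, so
division by [1 - x] produces the partial sums. *)
Lemma psum_cumul c x : unit_series c ->
  unit_series (fun n => \sum_(0 <= k < n.+1) c k) -> `|x| < 1 ->
  psum c x = (1 - x) * psum (fun n => \sum_(0 <= k < n.+1) c k) x.
Proof.
move=> uc us x1; set s := (fun n => _) in us *.
rewrite mulrBl mul1r [in X in X - _](psum_shift us x1) /s big_nat1 (psum_shift uc x1).
have -> : (fun n => \sum_(0 <= k < n.+2) c k) =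
    (fun n => \sum_(0 <= k < n.+1) c k) + (fun n => c n.+1).
  by apply/funext => n; rewrite big_nat_recr.
rewrite psumD // ?mulrDr; last exact: unit_series_shift.
by ring.
Qed.

(** The iterated formal derivatives keep radius at least 1, and a two-sided
derivative restricts to difference quotients inside [0, 1[.  The function [f] need
not agree with the series outside [0, 1[, so it is kept as the 0th derivative. *)
Lemma smooth_psum c (f : R -> R) : unit_series c ->
  (forall z, 0 <= z < 1 -> f z = psum c z) -> smooth_on `[0, 1[%classic f.
Proof.
move=> uc fc; exists (fun n => if n is n'.+1 then psum (iter n (@pseries_diffs R) c) else f).
have ud n : unit_series (iter n (@pseries_diffs R) c).
  by elim: n => //= n IH; exact: unit_series_diffs.
split=> // n z; rewrite /= in_itv /= => z01.
have Dn t : 0 <= t < 1 ->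
    (if n is n'.+1 then psum (iter n (@pseries_diffs R) c) else f) t =
    psum (iter n (@pseries_diffs R) c) t by case: (n) => //; exact: fc.
have z1 : `|z| < 1 by case/andP: z01 => z0; rewrite ger0_norm.
have [dv dE] := psum_derive (ud n) z1.
have {dE}dv : h^-1 *: (psum (iter n (@pseries_diffs R) c) (h + z) -
    psum (iter n (@pseries_diffs R) c) z) @[h --> 0^'] -->
    psum (pseries_diffs (iter n (@pseries_diffs R) c)) z.
  rewrite -dE; move: dv; rewrite /derivable /derive.
  by under eq_fun do rewrite [_%:A]mulr1.
have to0 : (t - z) @[t --> within (`[0, 1[ `\ z) (nbhs z)] --> 0^'.
  move=> P; rewrite /= /nbhs /=.
  move=> [e /= e0 eP]; rewrite /within /=; exists e => //= t zt [_ tz].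
  apply: eP => /=; first by rewrite sub0r normrN distrC.
  by rewrite subr_eq0; apply/eqP.
have := cvg_comp _ _ to0 dv; apply: cvg_trans; apply: near_eq_cvg.
rewrite near_withinE; near=> t => -[/=]; rewrite in_itv /= => t01 tz.
by rewrite !Dn // subrK /GRing.scale /= mulrC.
Unshelve. all: by end_near. Qed.

End UnitSeries.

(** * The power series of a semiconvergent word *)

Section WordSeries.
Variable R : realType.
Implicit Types (w : seq letter) (x z : R).

(** Taylor coefficients at 0 of the polylogarithm of a word.  Division by [0%:R] yields
0, which is the right constant term of a function vanishing at 0. *)
Fixpoint word_coef (w : seq letter) (n : nat) : R :=
  if w is a :: w' then
    (if a is x_ then word_coef w' n else \sum_(0 <= k < n) word_coef w' k) / n%:R
  else (n == 0%N)%:R.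

Lemma word_coef_ge0_le1 w n : 0 <= word_coef w n <= 1.
Proof.
elim: w n => [|a w IH] [|n] //=; rewrite ?ler01 ?lexx //.
  by rewrite invr0 mulr0 lexx ler01.
case: a; last first.
  rewrite divr_ge0 ?ler0n ?sumr_ge0 //=; last by move=> i _; case/andP: (IH i).
  rewrite ler_pdivrMr ?ltr0n // mul1r.
  rewrite -[leRHS](_ : \sum_(0 <= k < n.+1) 1 = n.+1%:R); last first.
    by rewrite sumr_const_nat subn0.
  by apply: ler_sum_nat => i _; case/andP: (IH i).
have /andP[h0 h1] := IH n.+1; rewrite divr_ge0 //=.
by rewrite ler_pdivrMr ?ltr0n // mul1r (le_trans h1) // ler1n.
Qed.

Lemma word_coef0 w : word_coef w 0 = (w == [::])%:R.
Proof. by case: w => //= a w; rewrite invr0 mulr0. Qed.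

Lemma unit_word_coef w : unit_series (word_coef w).
Proof.
apply: unit_series_le1 => n; have /andP[h0 h1] := word_coef_ge0_le1 w n.
by rewrite ger0_norm.
Qed.

Lemma diffs_word_coef_x w :
  pseries_diffs (word_coef (x_ :: w)) = (fun n => word_coef w n.+1).
Proof. by apply/funext => n; rewrite /pseries_diffs /= mulrC divfK. Qed.

Lemma diffs_word_coef_y w : pseries_diffs (word_coef (y_ :: w)) =
  (fun n => \sum_(0 <= k < n.+1) word_coef w k).
Proof. by apply/funext => n; rewrite /pseries_diffs /= mulrC divfK. Qed.

Definition word_fun w : R -> R := psum (word_coef w).

(** Semiconvergence enters for the letter [x_] only: the remaining word is then
nonempty, its series has no constant term and may be divided by [z]. *)
Lemma word_fun_derive a w z : word_semiconv (a :: w) -> 0 < z < 1 ->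
  is_derive z 1 (word_fun (a :: w)) (sigma a z * word_fun w z).
Proof.
move=> sw /andP[z0 z1]; have nz1 : `|z| < 1 by rewrite gtr0_norm.
have := psum_derive (@unit_word_coef (a :: w)) nz1.
suff -> : psum (pseries_diffs (word_coef (a :: w))) z = sigma a z * word_fun w z.
  by [].
have us := unit_series_diffs (@unit_word_coef (a :: w)).
case: a sw us => sw us.
  rewrite diffs_word_coef_x /word_fun (psum_shift (@unit_word_coef w) nz1).
  rewrite word_coef0; have /negPf -> : w != [::] by case: (w) sw.
  by rewrite add0r mulKf // gt_eqF.
rewrite diffs_word_coef_y in us *.
by rewrite /word_fun (psum_cumul (@unit_word_coef w) us nz1) mulKf // subr_eq0 gt_eqF.
Qed.

Lemma word_fun_nil z : `|z| < 1 -> word_fun [::] z = 1.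
Proof.
move=> z1; rewrite /word_fun (psum_shift (@unit_word_coef [::]) z1) /=.
have -> : (fun n => (n.+1 == 0%N)%:R) = 0 :> R^nat by apply/funext.
by rewrite psum0 mulr0 addr0.
Qed.

Lemma word_fun_ge0 w z : 0 <= z < 1 -> 0 <= word_fun w z.
Proof.
move=> /andP[z0 z1]; apply: limr_ge.
  by apply: unit_series_cvg; [exact: unit_word_coef|rewrite ger0_norm].
apply: nearW => n; rewrite /pseries /series /= sumr_ge0 // => i _.
by rewrite mulr_ge0 ?exprn_ge0 //; case/andP: (word_coef_ge0_le1 w i).
Qed.

(** Comparison with the geometric series; only its linear decay at 0 matters later. *)
Lemma word_fun_le w z : w != [::] -> 0 <= z < 1 -> word_fun w z <= z / (1 - z).
Proof.
move=> w0 /andP[z0 z1]; have nz1 : `|z| < 1 by rewrite ger0_norm.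
rewrite /word_fun (psum_shift (@unit_word_coef w) nz1) word_coef0 (negPf w0) add0r.
rewrite ler_wpM2l //; apply: limr_le.
  apply: unit_series_cvg nz1; apply: unit_series_shift; exact: unit_word_coef.
apply: nearW => n; apply: (@le_trans _ _ (series (geometric 1 z) n)).
  apply: ler_sum => i _; rewrite ler_wpM2r ?exprn_ge0 //.
  by case/andP: (word_coef_ge0_le1 w i.+1).
rewrite geometric_seriesE ?lt_eqF //= mul1r -[leRHS]mul1r.
rewrite ler_wpM2r ?invr_ge0 ?subr_ge0 ?(ltW z1) //.
by rewrite gerBl exprn_ge0.
Qed.

Lemma word_fun_continuous w (a b : R) : 0 <= a -> b < 1 ->
  {within `[a, b], continuous (word_fun w)}.
Proof.
move=> a0 b1; apply: derivable_within_continuous => z; rewrite in_itv /= => /andP[az zb].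
have z1 : `|z| < 1 by rewrite ger0_norm; lra.
by have [] := psum_derive (@unit_word_coef w) z1.
Qed.

End WordSeries.

(** * Primitives vanishing at the left endpoint *)

Section Primitives.
Variables (R : realType) (a b : R).
Implicit Types (f g F G : R -> R) (x z : R).

Local Notation mu := (@lebesgue_measure R).

Definition primitive g f := [/\ f a = 0, {within `[a, b], continuous f} &
  forall z, a < z < b -> is_derive z 1 f (g z)].

(** All identities and estimates between iterated integrals are obtained from this
comparison principle, instead of from manipulations of integrals. *)
Lemma le_of_derive_le f F g G : {within `[a, b], continuous f} ->
  {within `[a, b], continuous F} ->
  (forall z, a < z < b -> is_derive z 1 f (g z)) ->
  (forall z, a < z < b -> is_derive z 1 F (G z)) ->
  (forall z, a < z < b -> g z <= G z) -> f a <= F a ->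
  forall z, a <= z <= b -> f z <= F z.
Proof.
move=> cf cF df dF gG fFa z /andP[az zb].
have hD x : x \in `]a, b[ -> is_derive x 1 (F - f) (G x - g x).
  by rewrite in_itv /= => xab; apply: is_deriveB; [exact: dF|exact: df].
have c : {within `[a, b], continuous (F - f)}.
  by apply: within_continuousB.
have := @ger0_derive1_le_cc R (F - f) a b _ _ c a z.
rewrite !in_itv /= lexx az zb (le_trans az zb) => h.
have : (F - f) a <= (F - f) z.
  apply: h => // x xab; first by have [] := hD x xab.
  rewrite derive1E; have [_ ->] := hD x xab.
  by rewrite subr_ge0 gG //; move: xab; rewrite in_itv.
rewrite !fctE; lra.
Qed.

Lemma primitive_uniq g G f F : primitive g f -> primitive G F ->
  (forall z, a < z < b -> g z = G z) ->
  forall z, a <= z <= b -> f z = F z.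
Proof.
move=> [f0 cf df] [F0 cF dF] gG z zab; apply/le_anti/andP; split.
  by apply: le_of_derive_le df dF _ _ _ zab => // [x /gG ->|]; rewrite ?f0 ?F0.
by apply: le_of_derive_le dF df _ _ _ zab => // [x /gG ->|]; rewrite ?f0 ?F0.
Qed.

Lemma primitive_integral g : a < b -> {within `[a, b], continuous g} ->
  primitive g (fun z => \int[mu]_(u in `[a, z]) g u)%R.
Proof.
move=> ab cg; have ig : mu.-integrable `[a, b] (EFin \o g).
  by apply: continuous_compact_integrable => //; exact: segment_compact.
split.
- by rewrite set_itv1 Rintegral_set1.
- exact: parameterized_integral_continuous (ltW ab) ig.
- move=> z /andP[az zb]; have [] := @continuous_FTC1_closed R g a z b zb ig az.
    have [+ _ _] := (continuous_within_itvP g ab).1 cg; apply.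
    by rewrite in_itv /= az zb.
  by move=> d e; split=> //; rewrite -derive1E.
Qed.

Lemma primitiveD g G f F : primitive g f -> primitive G F ->
  primitive (g + G) (f + F).
Proof.
move=> [f0 cf df] [F0 cF dF]; split.
- by rewrite fctE f0 F0 addr0.
- exact: within_continuousD.
- by move=> z zab; apply: is_deriveD; [exact: df|exact: dF].
Qed.

Lemma primitive0 : primitive 0 0.
Proof.
split=> //; first by apply: continuous_subspaceT => z; exact: cst_continuous.
by move=> z _; exact: is_derive_cst.
Qed.

Lemma primitive_sum (I : eqType) (s : seq I) (g f : I -> R -> R) :
  (forall i, i \in s -> primitive (g i) (f i)) ->
  primitive (\sum_(i <- s) g i) (\sum_(i <- s) f i).
Proof.
elim: s => [|i s IH] h; first by rewrite !big_nil; exact: primitive0.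
rewrite !big_cons; apply: primitiveD; first by apply: h; rewrite mem_head.
by apply: IH => j js; apply: h; rewrite in_cons js orbT.
Qed.

(** Integration by parts, in the form of the Leibniz rule. *)
Lemma primitiveM g G f F : primitive g f -> primitive G F ->
  primitive (g * F + f * G) (f * F).
Proof.
move=> [f0 cf df] [F0 cF dF]; split.
- by rewrite fctE f0 mul0r.
- by move=> z; apply: continuousM; [exact: cf|exact: cF].
- move=> z zab; have dfz := df z zab; have dFz := dF z zab.
  apply: (is_derive_eq (is_deriveM dfz dFz)).
  by rewrite !fctE /GRing.scale /=; ring.
Qed.

End Primitives.

(** * Arborification of the truncated integrals *)

Section WordIntegrals.
Variables (R : realType) (eps b : R).
Hypotheses (eps0 : 0 < eps) (epsb : eps < b) (b1 : b < 1).
Implicit Types (u v w : seq letter) (z : R).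

Lemma A_ladder_cons (e : R) a w : A_ e (ladder (a :: w)) =
  (fun z => \int[@lebesgue_measure R]_(t in `[e, z])
              (sigma a t * A_ e (ladder w) t))%R.
Proof. by apply/funext => z; rewrite /= A_bplus. Qed.

Lemma A_ladder_nil (e : R) : A_ e (ladder [::]) = (fun=> 1).
Proof. by apply/funext => z; rewrite /= A_empty. Qed.

Lemma sigma_continuous a : {within `[eps, b], continuous (@sigma R a)}.
Proof.
apply: derivable_within_continuous => z; rewrite in_itv /= => /andP[ez zb].
case: a => /=; apply: derivableV => //; first by rewrite gt_eqF // (lt_le_trans eps0).
  by rewrite subr_eq0 gt_eqF // (le_lt_trans zb).
Qed.

Lemma A_ladder_continuous w : {within `[eps, b], continuous (A_ eps (ladder w))}.
Proof.
elim: w => [|a w IH].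
  by rewrite A_ladder_nil; apply: continuous_subspaceT => z; exact: cst_continuous.
rewrite A_ladder_cons.
have cg : {within `[eps, b], continuous (fun t => sigma a t * A_ eps (ladder w) t)}.
  by move=> z; apply: continuousM; [exact: sigma_continuous|exact: IH].
by have [_ ] := primitive_integral epsb cg.
Qed.

Lemma A_ladder_sum_continuous (W : seq (seq letter)) :
  {within `[eps, b], continuous (fun x => \sum_(w <- W) A_ eps (ladder w) x)}.
Proof.
elim: W => [|w W IH].
  have -> : (fun x => \sum_(w <- [::]) A_ eps (ladder w) x) = cst 0.
    by apply/funext => x; rewrite big_nil.
  by apply: continuous_subspaceT => z; exact: cst_continuous.
have -> : (fun x => \sum_(v <- w :: W) A_ eps (ladder v) x) =
    (fun x => A_ eps (ladder w) x + \sum_(v <- W) A_ eps (ladder v) x).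
  by apply/funext => x; rewrite big_cons.
exact: (within_continuousD (@A_ladder_continuous w) IH).
Qed.

(** The derivative of [A_ eps (ladder w)], given for all words at once so that it can be
summed over a list of shuffles. *)
Definition dA_ladder w : R -> R :=
  if w is a :: w' then fun z => sigma a z * A_ eps (ladder w') z else 0.

Lemma A_ladder_primitive w : w != [::] ->
  primitive eps b (dA_ladder w) (A_ eps (ladder w)).
Proof.
case: w => // a w _; rewrite A_ladder_cons; apply: primitive_integral => //.
move=> z; apply: continuousM; [exact: sigma_continuous|exact: A_ladder_continuous].
Qed.

(** Differentiating the product removes the first letter of [u] or that of [v], which
is also how the shuffles of [u] and [v] start. *)
Lemma A_ladder_shuffle u v z : eps <= z <= b ->
  A_ eps (ladder u) z * A_ eps (ladder v) z =
  \sum_(w <- shuffle u v) A_ eps (ladder w) z.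
Proof.
move: u v z; apply: shuffle_ind => [v z _|u z _|a u c v IHu IHv z zb].
- by rewrite big_seq1 A_ladder_nil mul1r.
- by rewrite shuffle0r big_seq1 A_ladder_nil mulr1.
have pu : primitive eps b (dA_ladder (a :: u)) (A_ eps (ladder (a :: u))).
  exact: A_ladder_primitive.
have pv : primitive eps b (dA_ladder (c :: v)) (A_ eps (ladder (c :: v))).
  exact: A_ladder_primitive.
have ps := @primitive_sum R eps b _ (shuffle (a :: u) (c :: v)) dA_ladder
  (fun w => A_ eps (ladder w)) _.
rewrite -[RHS](_ : (\sum_(w <- shuffle (a :: u) (c :: v)) A_ eps (ladder w)) z = _);
  last by rewrite fct_sumE.
(* The two sides have the same derivative, by the induction hypotheses. *)
apply: (primitive_uniq (primitiveM pu pv) (ps _)) zb => [w|x /andP[ex xb]].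
  move/size_shuffle; case: w => // aw w _; exact: A_ladder_primitive.
rewrite fct_sumE shuffle_cons big_cat !big_map /= -!mulr_sumr.
have exb : eps <= x <= b by rewrite !ltW.
rewrite -(IHu x exb) -(IHv x exb) !fctE /=; ring.
Qed.

Lemma A_ladder_shuffles U V z : eps <= z <= b ->
  (\sum_(u <- U) A_ eps (ladder u) z) * (\sum_(v <- V) A_ eps (ladder v) z) =
  \sum_(w <- shuffles U V) A_ eps (ladder w) z.
Proof.
move=> zb; rewrite /shuffles big_flatten big_allpairs_dep /= mulr_suml.
apply: eq_bigr => u _; rewrite mulr_sumr; apply: eq_bigr => v _.
exact: A_ladder_shuffle.
Qed.

Lemma pA_prod (s : seq (ptree letter)) z : eps <= z <= b ->
  List.Forall (fun t => pA eps t z =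
     \sum_(w <- tree_words t) A_ eps (ladder w) z) s ->
  \prod_(t <- s) pA eps t z = \sum_(w <- trees_words s) A_ eps (ladder w) z.
Proof.
move=> zb; elim=> {s} [|t s ht _ IH] /=; first by rewrite big_nil big_seq1 A_ladder_nil.
by rewrite big_cons ht IH A_ladder_shuffles.
Qed.

(** The integrand of the root is a product over the subtrees, turned by induction into
a sum over words, to each of which the root letter is then prepended. *)
Lemma pA_words t z : eps <= z <= b ->
  pA eps t z = \sum_(w <- tree_words t) A_ eps (ladder w) z.
Proof.
elim/ptree_nested_ind: t z => a s IH z /[dup] zb /andP[ez zb'].
pose g (x : R) := sigma a x * \sum_(w <- trees_words s) A_ eps (ladder w) x.
rewrite pA_node; transitivity (\int[@lebesgue_measure R]_(x in `[eps, z]) g x)%R.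
  apply: eq_Rintegral => x; rewrite inE /= in_itv /= => /andP[ex xz]; rewrite /g; congr (_ * _).
  have xb : eps <= x <= b by rewrite ex (le_trans xz).
  by apply: pA_prod => //; elim: IH => [|t r ht _ IHr]; constructor; [exact: ht|].
have pw w : primitive eps b (fun x => sigma a x * A_ eps (ladder w) x)
    (A_ eps (ladder (a :: w))) by exact: (@A_ladder_primitive (a :: w)).
rewrite tree_wordsE big_map.
rewrite -[RHS](_ : (\sum_(w <- trees_words s) A_ eps (ladder (a :: w))) z = _);
  last by rewrite fct_sumE.
apply: (primitive_uniq (primitive_integral epsb _) (primitive_sum _)) zb.
- move=> x; apply: continuousM; [exact: sigma_continuous|exact: A_ladder_sum_continuous].
- by move=> w _; exact: pw.
- by move=> x _; rewrite fct_sumE /g mulr_sumr.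
Qed.

Lemma A_words F z : eps <= z <= b ->
  A_ eps F z = \sum_(w <- forest_words F) A_ eps (ladder w) z.
Proof.
move=> zb; rewrite -pA_prod ?big_map //.
by elim: (components F) => [|t s IH]; constructor => //; exact: pA_words.
Qed.

End WordIntegrals.

(** * Convergence of the truncated integrals *)

Section Limit.
Variable R : realType.
Implicit Types (F G : forest letter) (w : seq letter) (b e z : R).

(** A common bound for both letters: the singularity [1 / z] at 0 dominates, and the
singularity at 1 is kept away by [b]. *)
Lemma sigma_le b a z : b < 1 -> 0 < z <= b -> 0 <= sigma a z <= (1 - b)^-1 / z.
Proof.
move=> b1 /andP[z0 zb]; have z1 := le_lt_trans zb b1.
have b10 : 0 < 1 - b by rewrite subr_gt0.
case: a => /=; first last.
  rewrite invr_ge0 subr_ge0 (ltW z1) /= ler_pdivlMr // mulrC ler_pdivrMr ?subr_gt0 //.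
  rewrite mulrC ler_pdivlMr //; nra.
rewrite invr_ge0 (ltW z0) /= -[leLHS]mul1r ler_wpM2r ?invr_ge0 ?(ltW z0) //.
rewrite -[leLHS]invr1 lef_pV2 ?posrE //; lra.
Qed.

(** Induction on the word, comparing derivatives.  The gap for [a :: w] starts from
the value of the series at [e], of order [e]; its derivative is [sigma a] times the gap
for [w], hence between 0 and [M * K * sqrt e / sqrt z] by [sigma_le], with
[M = (1 - b)^-1].  Integrating doubles the constant: [K] becomes [2 * M * K + M]. *)
Lemma word_fun_approx b w : b < 1 -> word_semiconv w ->
  exists2 K, 0 <= K & forall e z, 0 < e -> e < b -> e <= z <= b ->
    0 <= word_fun w z - A_ e (ladder w) z <= K * Num.sqrt e * Num.sqrt z.
Proof.
move=> b1; elim: w => [_|a w IH saw].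
  exists 0 => // e z e0 eb /andP[ez zb]; rewrite A_ladder_nil word_fun_nil.
    by rewrite subrr !mul0r lexx.
  by rewrite ger0_norm; lra.
have [|K K0 HK] := IH; first by move: saw; rewrite word_semiconv_cons => /andP[].
pose M := (1 - b)^-1; have M0 : 0 < M by rewrite invr_gt0 subr_gt0.
(* Integrating [M * K * sqrt e / sqrt z] yields [2 * M * K * sqrt e * sqrt z]; the last
   [M] pays for the initial value. *)
exists (2 * M * K + M) => [|e z e0 eb zb].
  by rewrite addr_ge0 // ?mulr_ge0 // ?ltW.
have [A0 cA dA] : primitive e b (dA_ladder e (a :: w)) (A_ e (ladder (a :: w))).
  exact: A_ladder_primitive.
have dL x : e < x < b ->
    is_derive x 1 (word_fun (a :: w)) (sigma a x * word_fun w x).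
  by move=> /andP[ex xb]; apply: word_fun_derive => //; lra.
have cL : {within `[e, b], continuous (word_fun (a :: w))}.
  by apply: word_fun_continuous b1; exact: ltW.
have sx x : e < x < b -> 0 <= sigma a x <= M / x.
  by move=> /andP[ex xb]; apply: sigma_le => //; lra.
have e01 : 0 <= e < 1 by lra.
apply/andP; split.
  rewrite subr_ge0; apply: le_of_derive_le cA cL dA dL _ _ _ zb => [x xb|].
    rewrite /= ler_wpM2l //; first by case/andP: (sx x xb).
    rewrite -subr_ge0; have /andP[ex xb'] := xb.
    have exb : e <= x <= b by rewrite !ltW.
    by have /andP[] := HK e x e0 eb exb.
  by rewrite A0; exact: word_fun_ge0.
(* The upper bound is moved to the other side, to compare the series with [S]. *)
pose C := (2 * M * K + M) * Num.sqrt e.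
rewrite lerBlDr; pose S := C *: (@Num.sqrt R) + A_ e (ladder (a :: w)).
have dS x : e < x < b ->
    is_derive x 1 S (C *: (2 * Num.sqrt x)^-1 + dA_ladder e (a :: w) x).
  move=> xb; apply: is_deriveD; last exact: dA.
  by apply: is_deriveZ; apply: is_derive1_sqrt; lra.
have cS : {within `[e, b], continuous S}.
  apply: within_continuousD cA; apply: continuous_subspaceT => x.
  by apply: cvgZr; exact: sqrt_continuous.
suff : word_fun (a :: w) z <= S z by [].
apply: le_of_derive_le cL cS dL dS _ _ _ zb => [x xb|].
  have /andP[ex xb'] := xb; have x0 := lt_trans e0 ex.
  have /andP[s0 sM] := sx x xb.
  have /andP[d0 dK] : 0 <= word_fun w x - A_ e (ladder w) x <=
      K * Num.sqrt e * Num.sqrt x by apply: HK => //; rewrite !ltW.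
  rewrite -lerBlDr /= -mulrBr.
  apply: le_trans (ler_pM s0 d0 sM dK) _.
  have qx : 0 < Num.sqrt x by rewrite sqrtr_gt0.
  have qe := sqrtr_ge0 e.
  have -> : M / x * (K * Num.sqrt e * Num.sqrt x) = M * K * Num.sqrt e / Num.sqrt x.
    by rewrite -{1}(sqr_sqrtr (ltW x0)); field; rewrite gt_eqF.
  have -> : C *: (2 * Num.sqrt x)^-1 =
      M * K * Num.sqrt e / Num.sqrt x + M * Num.sqrt e / (2 * Num.sqrt x).
    by rewrite /GRing.scale /= /C; field; rewrite gt_eqF.
  by rewrite lerDl divr_ge0 ?mulr_ge0 // ltW.
have -> : S e = (2 * M * K + M) * e.
  rewrite /S !fctE A0 addr0 /GRing.scale /= /C -{3}(sqr_sqrtr (ltW e0)).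
  by rewrite expr2 mulrA.
apply: le_trans (word_fun_le _ e01) _ => //.
have : e / (1 - e) <= M * e.
  rewrite mulrC ler_wpM2r ?(ltW e0) // lef_pV2 ?posrE; lra.
move/le_trans; apply; rewrite ler_wpM2r ?(ltW e0) // lerDr.
by rewrite !mulr_ge0 // ltW.
Qed.

Lemma A_ladder_cvg w z : word_semiconv w -> 0 < z < 1 ->
  A_ e (ladder w) z @[e --> 0^'+] --> word_fun w z.
Proof.
move=> sw /andP[z0 z1]; pose b := (1 + z) / 2.
have [zb b1] : z < b /\ b < 1 by rewrite /b; split; lra.
have [K K0 HK] := word_fun_approx b1 sw.
apply: (@squeeze_cvgr _ _ _ _ (fun e => word_fun w z - K * Num.sqrt e * Num.sqrt z)
  (fun=> word_fun w z)).
- near=> e.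
  have e0 : 0 < e by near: e; exact: nbhs_right_gt.
  have ez : e < z by near: e; exact: nbhs_right_lt.
  have : e <= z <= b by rewrite !ltW.
  move/(HK e z e0 (lt_trans ez zb)); rewrite subr_ge0 => /andP[-> h].
  by rewrite andbT lerBlDr -lerBlDl.
- rewrite -[X in _ --> X]subr0 -[X in _ --> _ - X](mul0r (Num.sqrt z)).
  apply: cvgB; first exact: cvg_cst.
  apply: cvgMl; rewrite -[X in _ --> X](mulr0 K); apply: cvgMr.
  rewrite -[X in _ --> X](sqrtr0 R).
  apply: cvg_at_right_filter; exact: sqrt_continuous.
- exact: cvg_cst.
Unshelve. all: by end_near. Qed.

Lemma cvg_sum_seq (T : Type) (I : eqType) (Fl : set_system T) (s : seq I)
    (f : I -> T -> R) (l : I -> R) : Filter Fl ->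
  (forall i, i \in s -> f i t @[t --> Fl] --> l i) ->
  \sum_(i <- s) f i t @[t --> Fl] --> \sum_(i <- s) l i.
Proof.
move=> FF; elim: s => [|i s IH] fl.
  rewrite big_nil; under eq_fun do rewrite big_nil; exact: cvg_cst.
rewrite big_cons; under eq_fun do rewrite big_cons.
apply: cvgD; first by apply: fl; rewrite mem_head.
by apply: IH => j js; apply: fl; rewrite in_cons js orbT.
Qed.

End Limit.

(** * Arborified polylogarithms *)

Section ArborifiedPolylog.
Variable R : realType.
Implicit Types (F G : forest letter) (w : seq letter) (z : R).

Definition forest_coef F : R^nat := \sum_(w <- forest_words F) word_coef R w.

Lemma unit_forest_coef F : unit_series (forest_coef F).
Proof. by apply: unit_series_sum => w; exact: unit_word_coef. Qed.

Lemma forest_fun_words F z : `|z| < 1 ->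
  psum (forest_coef F) z = \sum_(w <- forest_words F) word_fun w z.
Proof. by move=> z1; rewrite psum_sum // => w; exact: unit_word_coef. Qed.

Lemma A_cvg F z : semiconv F -> 0 < z < 1 ->
  A_ e F z @[e --> 0^'+] --> psum (forest_coef F) z.
Proof.
move=> sF z01; have /andP[z0 z1] := z01.
have nz1 : `|z| < 1 by rewrite gtr0_norm.
rewrite forest_fun_words //.
have h : \sum_(w <- forest_words F) A_ e (ladder w) z @[e --> 0^'+] -->
    \sum_(w <- forest_words F) word_fun w z.
  apply: cvg_sum_seq => w wF; apply: A_ladder_cvg => //.
  exact: (allP (forest_words_semiconv sF)).
apply: cvg_trans h; apply: near_eq_cvg; near=> e.
have e0 : 0 < e by near: e; exact: nbhs_right_gt.
have ez : e < z by near: e; exact: nbhs_right_lt.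
by rewrite (A_words e0 ez z1) // lexx ltW.
Unshelve. all: by end_near. Qed.

(** At [z = 0], where [LiT] is set by convention, the sum of the series is its constant
term, which counts the empty words among the words of [F]. *)
Lemma LiT_psum F z : semiconv F -> 0 <= z < 1 -> LiT F z = psum (forest_coef F) z.
Proof.
move=> sF /andP[z0 z1]; rewrite /LiT; case: eqVneq => [->|zn0].
  rewrite forest_fun_words ?normr0 ?ltr01 //.
  have -> : \sum_(w <- forest_words F) word_fun w 0 =
      \sum_(w <- forest_words F) (F == onecm _)%:R :> R.
    by apply: eq_big_seq => w wF; rewrite /word_fun psum_at0 word_coef0 (forest_words_nil wF).
  have [->|_] := eqVneq F (onecm _); first by rewrite forest_words1 big_seq1.
  by rewrite big1.
apply: cvg_lim => //; apply: A_cvg => //.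
by rewrite lt_neqAle eq_sym zn0 z0.
Qed.

Lemma ladder_eq1 w : (ladder w == onecm _) = (w == [::]).
Proof. by case: w => [|a w]; [rewrite !eqxx|rewrite /= cm1_eq1]. Qed.

Lemma Li_word_fun w z : word_semiconv w -> 0 <= z < 1 -> Li w z = word_fun w z.
Proof.
move=> sw /andP[z0 z1]; rewrite /Li /LiT ladder_eq1; case: eqVneq => [->|zn0].
  by rewrite /word_fun psum_at0 word_coef0.
by apply: cvg_lim => //; apply: A_ladder_cvg => //; rewrite lt_neqAle eq_sym zn0 z0.
Qed.

Lemma LiT_sum_Li F z : semiconv F -> 0 <= z < 1 ->
  LiT F z = \sum_(w <- forest_words F) Li w z.
Proof.
move=> sF z01; rewrite LiT_psum // forest_fun_words; last first.
  by case/andP: z01 => z0 z1; rewrite ger0_norm.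
apply: eq_big_seq => w wF; rewrite Li_word_fun //.
exact: (allP (forest_words_semiconv sF)).
Qed.

Lemma LiT_smooth F : semiconv F -> smooth_on `[0, 1[%classic (LiT F : R -> R).
Proof.
move=> sF; apply: (@smooth_psum R (forest_coef F)) => [|z z01].
  exact: unit_forest_coef.
exact: LiT_psum.
Qed.

Lemma LiT1 z : 0 <= z < 1 -> LiT (onecm _) z = 1.
Proof.
move=> z01; rewrite LiT_sum_Li ?semiconv1 // forest_words1 big_seq1.
by rewrite Li_word_fun // word_fun_nil //; case/andP: z01 => z0 z1; rewrite ger0_norm.
Qed.

(** Both limits exist by [A_cvg], so the limit of the product is the product. *)
Lemma LiT_mulcm F G z : semiconv F -> semiconv G -> 0 <= z < 1 ->
  LiT (mulcm F G) z = LiT F z * LiT G z.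
Proof.
move=> sF sG /andP[z0 z1]; rewrite /LiT; case: eqVneq => [_|zn0].
  by rewrite cmM_eq1 -natrM mulnb.
have z01 : 0 < z < 1 by rewrite lt_neqAle eq_sym zn0 z0.
rewrite (cvg_lim _ (A_cvg sF z01)) // (cvg_lim _ (A_cvg sG z01)) //.
apply: cvg_lim => //; under eq_fun do rewrite A_concat.
by apply: cvgM; exact: A_cvg.
Qed.

(** [LiT_lin] at a point, on the whole forest algebra: [mmap] provides its linearity,
while multiplicativity can only be expected on the semiconvergent span. *)
Definition LiT_ext z (P : forest_alg R letter) : R :=
  mmap idfun (fun F => LiT F z) P.

Lemma LiT_extD z P Q : LiT_ext z (P + Q) = LiT_ext z P + LiT_ext z Q.
Proof. exact: mmapD. Qed.

Lemma LiT_extZ z c P : LiT_ext z (c *: P) = c * LiT_ext z P.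
Proof.
rewrite /LiT_ext (mmapEw (msuppZ_le c P)) (mmapE _ _ P) mulr_sumr.
by apply: eq_bigr => F _; rewrite /= mcoeffZ mulrA.
Qed.

Lemma LiT_ext_forest z F : LiT_ext z (forest_vec R F) = LiT F z.
Proof. by rewrite /LiT_ext mmapU mul1r. Qed.

Lemma LiT_ext_comb z (s : seq (R * forest letter)) :
  LiT_ext z (\sum_(p <- s) p.1 *: forest_vec R p.2) = \sum_(p <- s) p.1 * LiT p.2 z.
Proof.
elim: s => [|p s IH]; first by rewrite !big_nil; exact: mmap0.
by rewrite !big_cons LiT_extD IH LiT_extZ LiT_ext_forest.
Qed.

Lemma forest_combM (s r : seq (R * forest letter)) :
  (\sum_(p <- s) p.1 *: forest_vec R p.2) * (\sum_(q <- r) q.1 *: forest_vec R q.2) =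
  \sum_(i <- [seq (p.1 * q.1, mulcm p.2 q.2) | p <- s, q <- r]) i.1 *: forest_vec R i.2.
Proof.
rewrite big_allpairs_dep mulr_suml; apply: eq_bigr => p _.
rewrite mulr_sumr; apply: eq_bigr => q _ /=.
by rewrite forest_vecM -scalerAl -scalerAr scalerA.
Qed.

(** Elements of the span are written as combinations of semiconvergent forests, so
that the multiplicativity on forests applies term by term. *)
Lemma LiT_extM z P Q : 0 <= z < 1 ->
  P \in @semiconv_span R -> Q \in @semiconv_span R ->
  LiT_ext z (P * Q) = LiT_ext z P * LiT_ext z Q.
Proof.
move=> z01 /asboolP[s /allP hs ->] /asboolP[r /allP hr ->].
rewrite forest_combM !LiT_ext_comb big_allpairs_dep mulr_suml.
apply: eq_big_seq => p ps; rewrite mulr_sumr; apply: eq_big_seq => q qr /=.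
by rewrite (LiT_mulcm (hs _ ps) (hr _ qr) z01) mulrACA.
Qed.

Lemma LiT_linE (P : semiconv_alg R) (z : Ico01 R) : LiT_lin P z = LiT_ext (val z) P.
Proof. by rewrite /LiT_lin fct_sumE. Qed.

Lemma LiT_lin_linear : linear (@LiT_lin R).
Proof.
move=> c P Q; apply/funext => z.
by rewrite !LiT_linE /= LiT_extD LiT_extZ -!LiT_linE.
Qed.

Lemma LiT_lin_monoid_morphism : GRing.monoid_morphism (@LiT_lin R).
Proof.
have z01 (z : Ico01 R) : 0 <= val z < 1 by have := valP z; rewrite in_itv.
split.
  apply/funext => z; rewrite LiT_linE /= -forest_vec1 LiT_ext_forest.
  exact: LiT1 (z01 z).
move=> P Q; apply/funext => z; rewrite LiT_linE /=.
by rewrite (LiT_extM (z01 z) (valP P) (valP Q)) -!LiT_linE.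
Qed.

End ArborifiedPolylog.

Theorem theorem2 (R : realType) :
  (forall F : forest letter, semiconv F ->
     (exists2 s : seq (rat * seq letter),
        all (fun p => word_semiconv p.2) s &
        forall z : R, z \in `[0, 1[ ->
          LiT F z = \sum_(p <- s) ratr p.1 * Li p.2 z)
     /\ smooth_on `[0, 1[%classic (LiT F : R -> R))
  /\ linear (@LiT_lin R) /\ GRing.monoid_morphism (@LiT_lin R).
Proof.
split; last by split; [exact: LiT_lin_linear|exact: LiT_lin_monoid_morphism].
move=> F sF; split; last exact: LiT_smooth.
exists [seq (1%:Q, w) | w <- forest_words F].
  by rewrite all_map; exact: forest_words_semiconv.
move=> z; rewrite in_itv /= => z01; rewrite LiT_sum_Li // big_map.
by apply: eq_bigr => w _; rewrite /= rmorph1 mul1r.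
Qed.
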